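(* Let $n,k$ be positive integers with $k\le 2\cdot 3^n$. Then: if $n\ge 2$, $v_3(s(2\cdot3^n,k))\le v_3(s(2\cdot3^n,1))=3^n-n-1$; if $n=1$, $v_3(s(2\cdot 3,k))\le v_3(s(2\cdot3,3))=2$.
   Context: $s(N,K)$ denotes the unsigned Stirling number of the first kind (the number of permutations of $N$ elements with exactly $K$ disjoint cycles). For a nonzero integer $x$, $v_3(x)$ is the exponent of the largest power of $3$ dividing $x$. *)

(* Defs.v *)
From mathcomp Require Import all_boot all_fingroup.

Set Implicit Arguments.
Unset Strict Implicit.
Unset Printing Implicit Defensive.

(* Unsigned Stirling number of the first kind s(N, K).  The set [porbits p]
   contains the singleton orbits, so fixed points count as cycles. *)
Definition stirling1 (N K : nat) : nat :=
  #|[set p : 'S_N | #|porbits p| == K]|.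

(* Main.v *)
Require Import Defs.
From mathcomp Require Import all_boot all_fingroup all_algebra.
From mathcomp Require Import zify ring.

(* Let L = 3^n, so that sum_k s(2L, k) x^k = x (x + 1) ... (x + 2L - 1).
   Centering at y = x + L turns this product into
     x (sum_(k < L) c_(k+1) y^(2k+1)),  where
     C_n(z) = prod_(i < L) (z - i^2) = sum_k c_k z^k.
   The multiples of 3 contribute prod_(i < L) (z - 9 i^2) to C_(n+1), and the
   other indices contribute a factor R_n with R_n = (z - 1)^(2L) mod 3^(n+1)
   (by induction, as R_(n+1) = R_n^3 mod 3^(n+2)).  Hence the coefficients of
   R_n have the valuations of the binomials 'C(2L, j), and in each convolution
   one term dominates, which gives the exact valuation cval n k of c_k.
   Expanding y^(2k+1) in powers of x, again one term dominates:
     v_3(s(2L, 2j+2)) = cval n (j+1),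
     v_3(s(2L, 2j+1)) = cval n (j+1) + v_3(2j+1) + n. *)

Set Implicit Arguments.
Unset Strict Implicit.
Unset Printing Implicit Defensive.
Import GRing.Theory.

(* The exact 3-adic valuation of the coefficient of 'X^k in
   \prod_(i < 3 ^ n) ('X - i ^ 2), for 0 < k <= 3 ^ n (see val3_cfact);
   outside this range the value is meaningless. *)
Fixpoint cval (n k : nat) : nat :=
  if n is n'.+1 then
    if k <= 3 ^ n' then 2 * (3 ^ n' - k) + cval n' k
    else n' - logn 3 (k - 3 ^ n')
  else 0.

(** * Inequalities for [cval] *)

Lemma logn3_le m n : 0 < m < 3 ^ n.+1 -> logn 3 m <= n.
Proof.
move=> /andP[m_gt0 lt_m]; rewrite -ltnS -(ltn_exp2l _ _ (isT : 1 < 3)).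
exact: leq_ltn_trans (dvdn_leq m_gt0 (pfactor_dvdnn 3 m)) lt_m.
Qed.

Lemma logn3_odd_le t : logn 3 (2 * t + 1) <= t.
Proof.
apply: logn3_le; rewrite addn1 /=.
elim: t => // t IH; rewrite expnS; lia.
Qed.

Lemma ltn_logn3 m : 0 < m -> logn 3 m < m.
Proof. by move=> ?; apply: ltn_logl. Qed.

Lemma cval_top n : cval n (3 ^ n) = 0.
Proof.
case: n => //= n; have n_gt0 : 0 < 3 ^ n by rewrite expn_gt0.
rewrite expnS ifF; last lia.
have -> : 3 * 3 ^ n - 3 ^ n = 2 * 3 ^ n by lia.
by rewrite lognM ?expn_gt0 // pfactorK //; lia.
Qed.

(** Lets the leading coefficient of [cfact9 n] dominate the one [d] places below it. With n = m + 1,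
    the upper range rests on v3(2 * 3^m - d) <= v3(d) when v3(d) < m. *)
Lemma cval_lower n d : 0 < d < 3 ^ n ->
  n < cval n (3 ^ n - d) + 2 * d + logn 3 d.
Proof.
case: n => [|n]; first by case: d => [|[]].
move=> /andP[d_gt0 lt_d] /=; rewrite expnS in lt_d *.
have n_lt : n < 3 ^ n by apply: ltn_expl.
case: ifP => [|/negbT]; first lia.
rewrite -ltnNge => lt_Ld.
have -> : 3 * 3 ^ n - d - 3 ^ n = 2 * 3 ^ n - d by lia.
have [lt_vn|] := ltnP (logn 3 d) n; last lia.
suff: logn 3 (2 * 3 ^ n - d) <= logn 3 d by lia.
rewrite leqNgt; apply/negP => lt_v.
have: 3 ^ (logn 3 d).+1 %| 2 * 3 ^ n - d by rewrite pfactor_dvdn //; lia.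
rewrite dvdn_subr; [|lia|by apply/dvdn_mull/dvdn_exp2l].
by rewrite pfactor_dvdn // ltnn.
Qed.

(** When [k <= 3 ^ n], the term of index [k - d] gains 2d from the factors 9 and n - v3(d) from R_n,
    more than [cval] can fall between [k] and [k - d]. *)
Lemma cval_slope n k d : 0 < d < k -> k <= 3 ^ n ->
  cval n k + logn 3 d < 2 * d + cval n (k - d) + n.
Proof.
move=> /andP[d_gt0 lt_dk]; elim: n => [|n IH] /= le_k; first lia.
have := ltn_logn3 d_gt0.
case: ifP => [le_k'|_]; last lia.
rewrite ifT; last lia.
by have := IH le_k'; lia.
Qed.

(** Moving from [j] to [j + t] in the expansion around X + 3^n brings a factor 3^(2nt); the spare
    [t] pays for v3(2t+1) in the odd case. *)
Lemma cval_drop n j t : 0 < j -> 0 < t -> j + t <= 3 ^ n ->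
  cval n j + t < cval n (j + t) + 2 * n * t.
Proof.
move=> j_gt0; elim: n t => [|n IH] t t_gt0 /= le_jt; first lia.
have slack : n + t < 2 * n.+1 * t by nia.
have [le_jt'|gt_jt] := leqP (j + t) (3 ^ n).
  by rewrite ifT; [have := IH t t_gt0 le_jt'; nia | lia].
case: ifP => le_j; last lia.
have [lt_j|ge_j] := ltnP j (3 ^ n); last first.
  have -> : j = 3 ^ n by lia.
  by rewrite cval_top subnn; lia.
have := IH (3 ^ n - j); rewrite subnKC // cval_top; nia.
Qed.

Lemma cval1 n : cval n 1 + 2 * n + 1 = 3 ^ n.
Proof. by elim: n => //= n; rewrite expnS expn_gt0 /=; lia. Qed.

Lemma leq_mul_exp3 n : 0 < n -> 3 * n <= 3 ^ n.
Proof. by case: n => // n _; rewrite expnS leq_mul2l ltn_expl. Qed.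

Lemma cval_le n k : 0 < n -> 0 < k -> cval n k + 2 * n + 1 <= 3 ^ n.
Proof.
case: n => // n _ k_gt0; elim: n => [|n IH]; first by case: k k_gt0 => [|[]].
move: n.+1 IH => m IH; have := @leq_mul_exp3 m.+1 isT; rewrite expnS /=.
case: ifP; lia.
Qed.

(** In the lower range the index costs 2j and v3(2j+1) <= j regains at most half. For [n = 1] the
    bound fails at [j = 1], whence the exceptional case of the theorem. *)
Lemma cval_odd_le n j : 1 < n -> j < 3 ^ n ->
  cval n j.+1 + logn 3 (2 * j + 1) <= cval n 1.
Proof.
case: n => // n n_gt0 lt_j.
(* Exactly what the upper range needs: the left side is at most 2n + 1 there, and [cval n.+1 1] is
   3^(n+1) - 2(n+1) - 1. *)
have le4 : 4 * n.+1 <= 3 ^ n.+1.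
  case: n n_gt0 {lt_j} => // n _; rewrite expnS.
  by have := @leq_mul_exp3 n.+1 isT; lia.
have := logn3_odd_le j; have := cval1 n; have := @cval_le n j.+1 n_gt0 isT.
rewrite /= expn_gt0 /=; case: ifP => [le_j|_]; first lia.
have : logn 3 (2 * j + 1) <= n.+1.
  by apply: logn3_le; rewrite !expnS in lt_j *; lia.
by rewrite expnS in le4; lia.
Qed.

(** * Valuations of the binomials in row 2 * 3^n *)

Lemma ndvd3_bin n j : j < 3 ^ n -> ~~ (3 %| 'C((2 * 3 ^ n).-1, j)).
Proof.
elim: j => [|j IH] lt_j; first by rewrite bin0.
have L_gt0 : 0 < 2 * 3 ^ n by rewrite muln_gt0 expn_gt0.
(* With L = 3^n, (j+1) C(2L, j+1) = 2L C(2L-1, j) and v3(j+1) < n; Pascal's rule then passes from j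
   to j+1. *)
have dvd_b : 3 %| 'C(2 * 3 ^ n, j.+1).
  have: 3 ^ n %| j.+1 * 'C(2 * 3 ^ n, j.+1).
    by rewrite -mul_bin_diag dvdn_mulr ?dvdn_mull.
  rewrite !pfactor_dvdn ?muln_gt0 ?bin_gt0 //; last lia.
  rewrite lognM ?bin_gt0 //; last lia.
  have lt_v: logn 3 j.+1 < n.
    case: n lt_j {IH L_gt0} => // n lt_j; rewrite ltnS; exact: logn3_le.
  move=> le_n; have : 0 < logn 3 'C(2 * 3 ^ n, j.+1) by lia.
  by rewrite logn_gt0 mem_primes => /and3P[].
move: dvd_b; rewrite -(prednK L_gt0) binS => dvd_b.
apply/negP => dvd_b1; move: dvd_b; rewrite dvdn_addr //.
by apply/negP/IH; lia.
Qed.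

Lemma logn3_bin n j : 0 < j <= 2 * 3 ^ n ->
  logn 3 'C(2 * 3 ^ n, j) + logn 3 j = n.
Proof.
case: j => // j /= le_j.
have ndvd : ~~ (3 %| 'C((2 * 3 ^ n).-1, j)).
  have [|ge_j] := ltnP j (3 ^ n); first exact: ndvd3_bin.
  by rewrite -bin_sub; [apply: ndvd3_bin; lia | lia].
have b_gt0 : 0 < 'C((2 * 3 ^ n).-1, j) by rewrite bin_gt0; lia.
rewrite addnC -lognM ?bin_gt0 // -mul_bin_diag lognM // ?muln_gt0 ?expn_gt0 //.
rewrite lognM ?expn_gt0 // pfactorK //.
by rewrite (logn_coprime (m := 'C(_, _))) ?addn0 // prime_coprime.
Qed.

(** * Cycle counts and the generating function of the Stirling numbers *)

Section LiftPerm.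
Local Open Scope group_scope.
Variable n : nat.
Implicit Types (i j : 'I_n) (s : 'S_n).
Let m : 'I_n.+1 := ord_max.

Lemma lift_permX s k : lift_perm m m s ^+ k = lift_perm m m (s ^+ k).
Proof. by elim: k => [|k IH]; rewrite ?lift_perm1 // !expgS IH lift_permM. Qed.

Lemma porbit_lift_perm_max s : porbit (lift_perm m m s) m = [set m].
Proof.
apply/setP => x; rewrite inE; apply/porbitP/eqP => [[k ->]|->].
  by rewrite lift_permX lift_perm_id.
by exists 0; rewrite perm1.
Qed.

Lemma porbit_lift_perm_lift s i :
  porbit (lift_perm m m s) (lift m i) = lift m @: porbit s i.
Proof.
apply/setP => x; apply/porbitP/imsetP => [[k ->]|[j /porbitP[k ->] ->]].
  by exists ((s ^+ k) i); rewrite ?mem_porbit // lift_permX lift_perm_lift.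
by exists k; rewrite lift_permX lift_perm_lift.
Qed.

Lemma card_porbits_lift_perm s :
  #|porbits (lift_perm m m s)| = #|porbits s|.+1.
Proof.
have -> : porbits (lift_perm m m s) =
    [set m] |: [set lift m @: A | A : {set 'I_n} in porbits s].
  apply/setP => A; rewrite in_setU1; apply/imsetP/idP => [[x _ ->]|].
    case: (unliftP m x) => [i|] ->; last by rewrite porbit_lift_perm_max eqxx.
    by rewrite porbit_lift_perm_lift !imset_f ?orbT // inE.
  case/predU1P => [->|/imsetP[B /imsetP[i _ ->] ->]].
    by exists m; rewrite ?porbit_lift_perm_max.
  by exists (lift m i); rewrite ?porbit_lift_perm_lift.
rewrite cardsU1 card_imset; last exact/imset_inj/lift_inj.
suff -> : [set m] \notin [set lift m @: A | A : {set 'I_n} in porbits s] by [].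
apply/imsetP => -[A _ /setP/(_ m)]; rewrite inE eqxx => /esym/imsetP[i _ eq_m].
by have := neq_lift m i; rewrite -eq_m eqxx.
Qed.

(* Every permutation of 'I_n.+1 arises exactly once by multiplying a
   permutation fixing ord_max by a transposition tperm ord_max j; it merges
   the fixed point into the cycle of j unless j = ord_max. *)
Definition insert_max (sj : 'S_n * 'I_n.+1) : 'S_n.+1 :=
  tperm m sj.2 * lift_perm m m sj.1.

Lemma card_porbits_insert_max s (j : 'I_n.+1) :
  #|porbits (insert_max (s, j))| = #|porbits s| + (j == m).
Proof.
rewrite /insert_max /=; have := porbits_mul_tperm (lift_perm m m s) m j.
rewrite card_porbits_lift_perm porbit_sym porbit_lift_perm_max inE.
by rewrite (eq_sym m j); case: eqP => _ /=; rewrite ?addn0 ?addn1 ?addn2 => // -[].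
Qed.

(** The index [j] is recovered as the preimage of [ord_max]; injectivity suffices by cardinality. *)
Lemma insert_max_bij : bijective insert_max.
Proof.
apply: inj_card_bij => [[s j] [s' j'] /= eq_p|]; last first.
  by rewrite card_prod !card_Sn card_ord factS mulnC.
have insertE t l : insert_max (t, l) l = m.
  by rewrite permM tpermR lift_perm_id.
have eq_j : j = j'.
  by apply: (@perm_inj _ (insert_max (s, j))); rewrite insertE eq_p insertE.
move: eq_p; rewrite /insert_max -eq_j /= => /mulgI eq_l; congr pair.
apply/permP => i; apply: (@lift_inj _ m).
by rewrite -!(lift_perm_lift m m) eq_l.
Qed.

End LiftPerm.

Local Open Scope ring_scope.

(** Inserting the new element as a fixed point gives ['X]; the N other positions give the constant
    N. *)
Lemma stirling1_prod N :
  \prod_(i < N) ('X + (i%:R)%:P) =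
  \sum_(p : 'S_N) 'X^#|porbits p| :> {poly int}.
Proof.
elim: N => [|N IH].
  rewrite big_ord0 (big_pred1 1%g) => [|p]; last first.
    by apply/esym/eqP/permP; case.
  by rewrite (eq_card0 (A := porbits _)) // => A; apply/imsetP => -[[]].
rewrite big_ord_recr /= IH (reindex _ (onW_bij _ (insert_max_bij N))) /=.
rewrite -(pair_bigA _ (fun s j => 'X^#|porbits (insert_max (s, j))|)) /=.
rewrite mulr_suml; apply: eq_bigr => s _.
rewrite (bigD1 ord_max) //= card_porbits_insert_max eqxx addn1 exprSr mulrDr.
congr (_ + _); rewrite (eq_bigr (fun=> 'X^#|porbits s|)) => [|j /negPf j_neq].
  rewrite sumr_const cardC1 card_ord /= polyC_natr mulr_natr //.
by rewrite card_porbits_insert_max j_neq addn0.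
Qed.

Lemma stirling1_coef N k :
  (stirling1 N k)%:R = (\prod_(i < N) ('X + (i%:R)%:P) : {poly int})`_k.
Proof.
rewrite stirling1_prod coef_sum (eq_bigr (fun p => (#|porbits p| == k)%:R)).
  rewrite -natr_sum /stirling1 -sum1_card big_mkcond; congr _%:R.
  by apply: eq_bigr => p _; rewrite inE; case: eqP.
by move=> p _; rewrite coefXn eq_sym.
Qed.

(** * Exact 3-adic valuations of signed integers *)

Definition val3 (x : int) (e : nat) : Prop :=
  exists2 u : int, x = 3 ^+ e * u & ~~ (3 %| u)%Z.

Lemma val3_logn m e : val3 m%:R e -> logn 3 m = e.
Proof.
case=> u eq_m ndvd.
have -> : m = (3 ^ e * `|u|)%N.
  by have := congr1 absz eq_m; rewrite natz abszM abszX.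
have u_gt0 : (0 < `|u|)%N by rewrite absz_gt0; apply: contraNneq ndvd => ->.
rewrite lognM ?expn_gt0 // pfactorK // logn_coprime ?addn0 //.
by rewrite prime_coprime.
Qed.

Lemma val3_nat m : (0 < m)%N -> val3 m%:R (logn 3 m).
Proof.
move=> m_gt0; have [u co_u eq_m] := pfactor_coprime (isT : prime 3) m_gt0.
exists u%:R; last by rewrite natz dvdzE /= -prime_coprime.
by rewrite {1}eq_m natrM natrX mulrC.
Qed.

Lemma val3M x y a b : val3 x a -> val3 y b -> val3 (x * y) (a + b).
Proof.
move=> [u -> nu] [v -> nv]; exists (u * v); first by rewrite exprD; ring.
by rewrite dvdzE abszM Euclid_dvdM // negb_or; apply/andP.
Qed.

Lemma val3X3 e : val3 (3 ^+ e) e.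
Proof. by exists 1; rewrite ?mulr1. Qed.

Lemma val3_sign k x e : val3 x e -> val3 ((-1) ^+ k * x) e.
Proof.
rewrite -[e in X in _ -> X]add0n; apply: val3M; exists ((-1) ^+ k).
  by rewrite mul1r.
by rewrite dvdzE abszX /= exp1n.
Qed.

Lemma val3_dvd x e m : val3 x e -> (m <= e)%N -> (3 ^+ m %| x)%Z.
Proof. by case=> u -> _ le_m; rewrite dvdz_mulr // dvdz_exp2l. Qed.

Lemma val3D x y e : val3 x e -> (3 ^+ e.+1 %| y)%Z -> val3 (x + y) e.
Proof.
case=> u -> ndvd /dvdzP[v ->]; exists (u + 3 * v); first by rewrite exprSr; ring.
by rewrite rpredDr // dvdz_mulr.
Qed.

Lemma val3_sum (I : finType) (F : I -> int) i0 e : val3 (F i0) e ->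
  (forall i, i != i0 -> (3 ^+ e.+1 %| F i)%Z) -> val3 (\sum_i F i) e.
Proof.
by move=> valF dvdF; rewrite (bigD1 i0) //=; apply/val3D/rpred_sum.
Qed.

(** * The congruence for R_n *)

Section Cong.
Variable R : comPzRingType.
Implicit Types p q m : R.

Definition cong m p q := exists h, p = q + m * h.

Lemma congM m p q p' q' : cong m p q -> cong m p' q' -> cong m (p * p') (q * q').
Proof.
by move=> [h ->] [k ->]; exists (h * q' + q * k + m * h * k); ring.
Qed.

Lemma cong_trans m p q r : cong m p q -> cong m q r -> cong m p r.
Proof. by move=> [h ->] [k ->]; exists (k + h); ring. Qed.

Lemma cong_prod m n (F G : nat -> R) : (forall i, cong m (F i) (G i)) ->
  cong m (\prod_(0 <= i < n) F i) (\prod_(0 <= i < n) G i).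
Proof.
move=> congF; apply: (big_ind2 (cong m)) => //; first by exists 0; ring.
by move=> *; apply: congM.
Qed.

Lemma cong_cube k p q :
  cong (3 ^+ k.+1) p q -> cong (3 ^+ k.+2) (p ^+ 3) (q ^+ 3).
Proof.
case=> h ->; exists (q ^+ 2 * h + 3 * 3 ^+ k * q * h ^+ 2 + 3 * (3 ^+ k) ^+ 2 * h ^+ 3).
by rewrite !exprS; ring.
Qed.

Lemma prod_nat_mod3 (m : nat) (F : nat -> R) : \prod_(0 <= i < 3 * m) F i =
  \prod_(0 <= i < m) (F (3 * i)%N * (F (3 * i + 1)%N * F (3 * i + 2)%N)).
Proof.
elim: m => [|m IH]; first by rewrite !big_geq.
rewrite mulnS addnC !addnS addn0 !big_nat_recr //= IH addn1 addn2; ring.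
Qed.

(** Groups indices congruent modulo [m], as the step from R_n to R_(n+1) requires. *)
Lemma prod_nat_thirds (m : nat) (F : nat -> R) : \prod_(0 <= i < 3 * m) F i =
  \prod_(0 <= i < m) (F i * F (i + m)%N * F (i + 2 * m)%N).
Proof.
have shift a b k : (b = a + m)%N -> k = a ->
    \prod_(a <= i < b) F i = \prod_(0 <= i < m) F (i + k)%N.
  by move=> -> ->; rewrite -[X in \prod_(X <= _ < _) _]add0n big_addn addKn.
rewrite !big_split /= -mulrA (@big_cat_nat _ _ _ m 0) //; last lia.
rewrite (@big_cat_nat _ _ _ (2 * m) m) /=; [|lia..].
by rewrite (shift m _ m) ?(shift (2 * m)%N _ (2 * m)%N) //; lia.
Qed.

(** This is R_n at [x]: the indices are those below 3^(n+1) prime to 3. *)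
Definition unit_squares n x : R := \prod_(0 <= i < 3 ^ n)
  ((x - (3 * i + 1)%:R ^+ 2) * (x - (3 * i + 2)%:R ^+ 2)).

(** With M = 3^(n+1), the squares move by 2aM + M^2 and 4aM + 4M^2; both the sum 6aM + 5M^2 and the
    product of these shifts vanish modulo 3M. *)
Lemma cong_three_squares (n a : nat) x :
  cong (3 ^+ n.+2)
    ((x - a%:R ^+ 2) * (x - (a + 3 ^ n.+1)%:R ^+ 2) * (x - (a + 2 * 3 ^ n.+1)%:R ^+ 2))
    ((x - a%:R ^+ 2) ^+ 3).
Proof.
rewrite !natrD addr0 natrX !exprS; set L := 3 ^+ n; set b := a%:R; set w := x - b ^+ 2.
exists (- w ^+ 2 * (2 * b + 5 * L) + w * (4 * L * (2 * b + 3 * L) * (b + 3 * L))).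
by rewrite /w; ring.
Qed.

Lemma cong_unit_squares n x :
  cong (3 ^+ n.+1) (unit_squares n x) ((x - 1) ^+ (2 * 3 ^ n)).
Proof.
elim: n => [|n IH]; first by rewrite /unit_squares big_nat1; exists (- (x - 1)); ring.
have -> : (2 * 3 ^ n.+1 = 2 * 3 ^ n * 3)%N by rewrite expnSr mulnA.
rewrite exprM; apply: cong_trans (cong_cube IH).
rewrite /unit_squares expnS prod_nat_thirds -prodrXl; apply: cong_prod => i.
have := congM (cong_three_squares n (3 * i + 1) x) (cong_three_squares n (3 * i + 2) x).
rewrite -exprMn; congr (cong _ _ _).
have shift c k : (3 * i + c + k * 3 ^ n.+1 = 3 * (i + k * 3 ^ n) + c)%N.
  by rewrite expnS; lia.
have := shift 1 1; have := shift 2 1; rewrite !mul1n => -> ->.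
by rewrite !shift; ring.
Qed.

End Cong.

(** * Coefficients of C_n and R_n *)

Lemma coef_XaddC_exp (R : comNzRingType) (c : R) n m :
  (('X + c%:P) ^+ n)`_m = c ^+ (n - m) *+ 'C(n, m).
Proof.
rewrite addrC exprDn coef_sum.
have [le_m|lt_n] := leqP m n; last first.
  rewrite bin_small // mulr0n big1 // => i _.
  rewrite coefMn -polyC_exp coefCM coefXn; case: eqP => [eq_m|_]; last by rewrite mulr0 mul0rn.
  by have := ltn_ord i; lia.
rewrite (bigD1 (Ordinal (le_m : m < n.+1)%N)) //= big1 => [|i neq_i].
  by rewrite addr0 coefMn -polyC_exp coefCM coefXn eqxx mulr1.
rewrite coefMn -polyC_exp coefCM coefXn.
by move: neq_i; rewrite -val_eqE eq_sym => /negPf ->; rewrite mulr0 mul0rn.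
Qed.

(** Homogeneity: replacing X by aX in the left product extracts one [a] per factor. *)
Lemma coef_prod_scale (R : comNzRingType) (I : Type) (r : seq I) (f : I -> R) a j :
  a ^+ j * (\prod_(i <- r) ('X - (a * f i)%:P))`_j =
  a ^+ size r * (\prod_(i <- r) ('X - (f i)%:P))`_j.
Proof.
elim: r j => [|i r IH] j.
  by rewrite !big_nil coef1 /=; case: j => // j; rewrite !mulr0.
rewrite !big_cons !mulrBl !coefB !coefXM !coefCM !mulrBr /= exprS.
have eqC : a ^+ j * (a * f i * (\prod_(k <- r) ('X - (a * f k)%:P))`_j) =
    a * a ^+ size r * (f i * (\prod_(k <- r) ('X - (f k)%:P))`_j).
  transitivity (a * f i * (a ^+ j * (\prod_(k <- r) ('X - (a * f k)%:P))`_j)).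
    by ring.
  by rewrite IH; ring.
rewrite eqC; case: j {eqC} => [|j] /=; first by rewrite !mulr0.
by rewrite exprS -!mulrA IH.
Qed.

Definition cfact n : {poly int} :=
  \prod_(0 <= i < 3 ^ n) ('X - (i%:R ^+ 2)%:P).

Definition cfact9 n : {poly int} :=
  \prod_(0 <= i < 3 ^ n) ('X - (9 * i%:R ^+ 2)%:P).

Lemma cfactS n : cfact n.+1 = cfact9 n * unit_squares n 'X.
Proof.
rewrite /cfact expnS prod_nat_mod3 big_split /=.
by congr (_ * _); apply: eq_bigr => i _;
  rewrite ?natrM ?exprMn -?natrX ?polyC_natr.
Qed.

Lemma coef_cfact9 n k : (k <= 3 ^ n)%N ->
  (cfact9 n)`_k = 3 ^+ (2 * (3 ^ n - k)) * (cfact n)`_k.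
Proof.
move=> le_k.
have := coef_prod_scale (index_iota 0 (3 ^ n)) (fun i => i%:R ^+ 2 : int) 9 k.
have -> : 9 ^+ size (index_iota 0 (3 ^ n)) = 9 ^+ k * 9 ^+ (3 ^ n - k) :> int.
  by rewrite size_iota subn0 -exprD subnKC.
rewrite -mulrA.
move=> /mulfI -> //; first by rewrite exprM.
by rewrite expf_eq0 andbF.
Qed.

Lemma size_cfact9 n : size (cfact9 n) = (3 ^ n).+1.
Proof. by rewrite size_prod_XsubC size_iota subn0. Qed.

Lemma size_cfact n : size (cfact n) = (3 ^ n).+1.
Proof. by rewrite size_prod_XsubC size_iota subn0. Qed.

Lemma coef0_cfact9 n : (cfact9 n)`_0 = 0.
Proof.
rewrite /cfact9 big_ltn ?expn_gt0 // expr0n mulr0 subr0.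
by rewrite coefXM.
Qed.

Lemma coef_unit_squares n j : exists h : int,
  (unit_squares n ('X : {poly int}))`_j =
  (-1) ^+ (2 * 3 ^ n - j) * 'C(2 * 3 ^ n, j)%:R + 3 ^+ n.+1 * h.
Proof.
have [h ->] := cong_unit_squares n ('X : {poly int}).
have -> : 3 ^+ n.+1 = (3 ^+ n.+1)%:P :> {poly int}.
  by rewrite polyC_exp polyC_natr.
exists h`_j; by rewrite coefD coefCM -[1]/(1%:P) -polyCN coef_XaddC_exp mulr_natr.
Qed.

Lemma val3_unit_squares n j : (0 < j <= 2 * 3 ^ n)%N ->
  val3 (unit_squares n ('X : {poly int}))`_j (n - logn 3 j).
Proof.
move=> j_bd; have [h ->] := coef_unit_squares n j.
have eq_n := logn3_bin j_bd.
have <- : logn 3 'C(2 * 3 ^ n, j) = (n - logn 3 j)%N by lia.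
apply: val3D; first by apply/val3_sign/val3_nat; rewrite bin_gt0; lia.
by apply/dvdz_mulr/dvdz_exp2l; lia.
Qed.

Lemma val3_unit_squares0 n : val3 (unit_squares n ('X : {poly int}))`_0 0.
Proof.
have [h ->] := coef_unit_squares n 0; apply: val3D.
  by apply/val3_sign; rewrite bin0; exists 1.
by apply/dvdz_mulr/dvdz_exp2l.
Qed.

Lemma dvdz_unit_squares n j : (2 * 3 ^ n < j)%N ->
  (3 ^+ n.+1 %| (unit_squares n ('X : {poly int}))`_j)%Z.
Proof.
move=> lt_j; have [h ->] := coef_unit_squares n j.
by rewrite bin_small // mulr0 add0r dvdz_mulr.
Qed.

Lemma dvdz_expM x y a b e : (3 ^+ a %| x)%Z -> (3 ^+ b %| y)%Z ->
  (e <= a + b)%N -> (3 ^+ e %| x * y)%Z.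
Proof.
move=> dvd_x dvd_y le_e; apply: (dvdz_trans (dvdz_exp2l 3 le_e)).
by rewrite exprD dvdz_mul.
Qed.

Lemma val3_cfact9 n k : val3 (cfact n)`_k (cval n k) -> (k <= 3 ^ n)%N ->
  val3 (cfact9 n)`_k (2 * (3 ^ n - k) + cval n k).
Proof. by move=> valc le_k; rewrite coef_cfact9 //; apply: val3M (val3X3 _) _. Qed.

(* In the convolution of the coefficients of cfact9 n and of the unit part,
   a single term has least valuation: the one with index k in cfact9 n when
   k <= 3 ^ n, and the one with index 3 ^ n (the leading coefficient of
   cfact9 n) otherwise. *)
Lemma val3_cfact n k : (0 < k <= 3 ^ n)%N -> val3 (cfact n)`_k (cval n k).
Proof.
elim: n k => [|n IH] k /andP[k_gt0 le_k].
  have -> : k = 1%N by case: k k_gt0 le_k => [|[]].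
  by rewrite /cfact big_nat1 subr0 coefX; exists 1.
have IH9 i : (0 < i <= 3 ^ n)%N -> val3 (cfact9 n)`_i (2 * (3 ^ n - i) + cval n i).
  by move=> i_bd; apply: val3_cfact9 (IH _ i_bd) _; case/andP: i_bd.
have L_gt0 : (0 < 3 ^ n)%N by rewrite expn_gt0.
rewrite cfactS coefM /=; case: ifP => [le_kL|/negbT gt_kL].
  apply: (@val3_sum _ _ ord_max) => [|i neq_i] /=.
    rewrite subnn -[X in val3 _ X]addn0.
    by apply: val3M (IH9 _ _) (val3_unit_squares0 n); rewrite k_gt0.
  have [->|i_gt0] := posnP i; first by rewrite coef0_cfact9 mul0r.
  have lt_i : (i < k)%N.
    by have := ltn_ord i; move: neq_i; rewrite -val_eqE /=; lia.
  apply: dvdz_expM.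
  - by apply: (val3_dvd (IH9 i _) (leqnn _)); lia.
  - by apply: (val3_dvd (@val3_unit_squares n (k - i) _) (leqnn _)); lia.
  have := @cval_slope n k (k - i); rewrite subKn; last lia.
  by lia.
have lt_L : (3 ^ n < k.+1)%N by lia.
rewrite expnS in le_k.
apply: (@val3_sum _ _ (Ordinal lt_L)) => [|i neq_i] /=.
  rewrite -[X in val3 _ X]add0n; apply: val3M; last by apply: val3_unit_squares; lia.
  have := IH9 (3 ^ n)%N; rewrite cval_top subnn; apply; lia.
have [->|i_gt0] := posnP i; first by rewrite coef0_cfact9 mul0r.
have [gt_i|le_i] := ltnP (3 ^ n) i.
  by rewrite nth_default ?size_cfact9 // mul0r.
have lt_i : (i < 3 ^ n)%N by move: neq_i; rewrite -val_eqE /=; lia.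
have dvd9 := val3_dvd (IH9 i ltac:(lia)) (leqnn _).
set d := (3 ^ n - i)%N in dvd9; set r := (k - 3 ^ n)%N.
have [lt_j|le_j] := ltnP (2 * 3 ^ n) (k - i).
  by apply: dvdz_expM dvd9 (dvdz_unit_squares lt_j) _; lia.
apply: dvdz_expM dvd9 (val3_dvd (@val3_unit_squares n (k - i) _) (leqnn _)) _.
  by lia.
have [le_v|gt_v] := leqP (logn 3 (k - i)) (logn 3 r); first by lia.
(* Since k - i = d + r and v3(k - i) > v3(r), a larger v3(d) would force a higher power of 3 to
   divide r. *)
have le_vd : (logn 3 d <= logn 3 r)%N.
  rewrite leqNgt; apply/negP => lt_v.
  have d_dvd : (3 ^ (logn 3 r).+1 %| d)%N by rewrite pfactor_dvdn //; lia.
  have: (3 ^ (logn 3 r).+1 %| d + r)%N.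
    by rewrite (_ : d + r = k - i)%N ?pfactor_dvdn //; lia.
  by rewrite dvdn_addr // pfactor_dvdn ?ltnn //; lia.
have : (logn 3 (k - i) <= n)%N by apply: logn3_le; rewrite expnS; lia.
have := @cval_lower n d; rewrite (_ : 3 ^ n - d = i)%N; last lia.
by lia.
Qed.

(** * Centering the rising factorial at X + 3^n *)

Lemma prod_shift_rev (R : comPzRingType) (x : R) m :
  x * \prod_(0 <= i < m) (x + m%:R - i%:R) =
  (x + m%:R) * \prod_(0 <= i < m) (x + i%:R).
Proof.
(* Both sides are the product of x + i over i <= m. *)
rewrite mulrC [in RHS]mulrC -big_nat_recr //= big_nat_recl // addr0 mulrC.
congr (_ * _); rewrite big_nat_rev; apply: eq_big_nat => i /andP[_ lt_i].
by rewrite add0n natrB //; ring.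
Qed.

(** By [prod_shift_rev], y times the left side is X times the product of (y - i)(y + i), that is X
    C_n(y^2); then y cancels. *)
Lemma rising_cfact n :
  \prod_(i < 2 * 3 ^ n) ('X + (i%:R)%:P) =
  'X * \sum_(k < 3 ^ n) (cfact n)`_k.+1 *:
         ('X + ((3 ^+ n)%:P)) ^+ (2 * k).+1 :> {poly int}.
Proof.
set y := 'X + (3 ^+ n)%:P; have yE : y = 'X + (3 ^ n)%:R.
  by rewrite /y polyC_exp polyC_natr natrX.
have y_neq0 : y != 0.
  by rewrite /y -[(3 ^+ n)%:P]opprK -polyCN polyXsubC_eq0.
have cfactE : cfact n \Po (y ^+ 2) =
    y * \sum_(k < 3 ^ n) (cfact n)`_k.+1 *: y ^+ (2 * k).+1.
  have c0 : (cfact n)`_0 = 0.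
    by rewrite /cfact big_ltn ?expn_gt0 // expr0n subr0 coefXM.
  rewrite comp_polyE size_cfact big_ord_recl c0 scale0r add0r mulr_sumr.
  by apply: eq_bigr => k _; rewrite -exprM /= mulnS -scalerAr -exprS.
apply: (mulfI y_neq0); rewrite mulrCA -cfactE /cfact rmorph_prod /=.
rewrite -(big_mkord predT (fun i => 'X + (i%:R)%:P)) mul2n -addnn.
rewrite (@big_cat_nat _ _ _ (3 ^ n)) ?leq_addr //= -{2}[(3 ^ n)%N]add0n big_addn addnK.
rewrite mulrA.
under [X in y * X]eq_bigr => i _ do rewrite polyC_natr.
rewrite {1}yE -prod_shift_rev -yE -mulrA; congr (_ * _).
rewrite -big_split /=; apply: eq_bigr => i _.
rewrite rmorphB /= comp_polyX comp_polyC polyC_exp !polyC_natr natrD yE.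
by ring.
Qed.

Lemma stirling1_cfact n m :
  (stirling1 (2 * 3 ^ n) m.+1)%:R = \sum_(k < 3 ^ n)
    (cfact n)`_k.+1 * (3 ^+ (n * ((2 * k).+1 - m)) * 'C((2 * k).+1, m)%:R) :> int.
Proof.
rewrite stirling1_coef rising_cfact coefXM /= coef_sum; apply: eq_bigr => k _.
by rewrite coefZ coef_XaddC_exp -exprM mulr_natr.
Qed.

(** * Valuations of the Stirling numbers and their maximum *)

Section Valuation.
Variables (n j : nat).
Hypotheses (lt_j : (j < 3 ^ n)%N).

Lemma logn3_stirling1_even :
  logn 3 (stirling1 (2 * 3 ^ n) (2 * j).+2) = cval n j.+1.
Proof.
apply: val3_logn; rewrite stirling1_cfact.
apply: (@val3_sum _ _ (Ordinal lt_j)) => [|k neq_k] /=.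
  by rewrite subnn muln0 binn !mulr1; apply: val3_cfact.
have lt_k := ltn_ord k.
have [lt_kj|le_jk] := ltnP k j; first by rewrite bin_small ?mulr0 ?dvdz0 //; lia.
have {neq_k} lt_jk : (j < k)%N by move: neq_k; rewrite -val_eqE /=; lia.
apply: dvdz_expM (val3_dvd (@val3_cfact n k.+1 lt_k) (leqnn _)) (dvdz_mulr _ (dvdzz _)) _.
have := @cval_drop n j.+1 (k - j); rewrite addSn subnKC; last lia.
have -> : ((2 * k).+1 - (2 * j).+1 = 2 * (k - j))%N by lia.
nia.
Qed.

(** With k = j + t, (2t+1) C(2k+1, 2j) = (2j+1) C(2k+1, 2j+1), and 3^t absorbs the loss v3(2t+1) <=
    t. *)
Lemma dvdz_bin_odd t :
  (3 ^+ (logn 3 (2 * j + 1)) %| (3 ^+ t * 'C((2 * (j + t)).+1, 2 * j)%:R))%Z.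
Proof.
rewrite -!natrX -natrM !natz dvdzE /=.
have b_gt0 : (0 < 'C((2 * (j + t)).+1, 2 * j))%N by rewrite bin_gt0; lia.
have b'_gt0 : (0 < 'C((2 * (j + t)).+1, (2 * j).+1))%N by rewrite bin_gt0; lia.
rewrite pfactor_dvdn ?muln_gt0 ?expn_gt0 //= lognM ?expn_gt0 // pfactorK //.
have := congr1 (logn 3) (mul_bin_left (2 * (j + t)).+1 (2 * j)).
rewrite !lognM //; try lia.
have -> : ((2 * (j + t)).+1 - 2 * j = 2 * t + 1)%N by lia.
by have := logn3_odd_le t; rewrite !addn1; lia.
Qed.

Lemma logn3_stirling1_odd : (0 < n)%N ->
  logn 3 (stirling1 (2 * 3 ^ n) (2 * j).+1) =
  (cval n j.+1 + logn 3 (2 * j + 1) + n)%N.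
Proof.
move=> n_gt0; apply: val3_logn; rewrite stirling1_cfact.
apply: (@val3_sum _ _ (Ordinal lt_j)) => [|k neq_k] /=.
  rewrite subSnn muln1 binSn -addnA [(logn _ _ + _)%N]addnC addn1.
  apply: val3M; first exact: val3_cfact.
  by apply: val3M; [apply: val3X3 | apply: val3_nat].
have lt_k := ltn_ord k.
have [lt_kj|le_jk] := ltnP k j; first by rewrite bin_small ?mulr0 ?dvdz0 //; lia.
have {neq_k} lt_jk : (j < k)%N by move: neq_k; rewrite -val_eqE /=; lia.
have -> : ((2 * k).+1 - 2 * j = (2 * (k - j)).+1)%N by lia.
set t := (k - j)%N; have kE : (j + t = k)%N by rewrite /t; lia.
(* Of the exponent n(2t+1), the amount [t] is reserved for [dvdz_bin_odd]. *)
have [s le_s] : exists s, (n * (2 * t).+1 = s + t)%N.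
  by exists (n * (2 * t).+1 - t)%N; nia.
rewrite le_s exprD -mulrA -[in X in 'C(X, _)]kE.
have dvd_c := val3_dvd (@val3_cfact n k.+1 lt_k) (leqnn _).
apply: dvdz_expM dvd_c (dvdz_expM (dvdz_exp2l 3 (leqnn s)) (dvdz_bin_odd t) (leqnn _)) _.
have := @cval_drop n j.+1 t; rewrite addSn kE; nia.
Qed.

End Valuation.

Local Close Scope ring_scope.

Theorem theorem1p5 (n k : nat) (n_gt0 : 0 < n) (k_gt0 : 0 < k)
    (k_le : k <= 2 * 3 ^ n) :
  (2 <= n ->
     logn 3 (stirling1 (2 * 3 ^ n) k) <= logn 3 (stirling1 (2 * 3 ^ n) 1) /\
     logn 3 (stirling1 (2 * 3 ^ n) 1) = 3 ^ n - n - 1) /\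
  (n = 1 ->
     logn 3 (stirling1 (2 * 3) k) <= logn 3 (stirling1 (2 * 3) 3) /\
     logn 3 (stirling1 (2 * 3) 3) = 2).
Proof.
have cases_k : (exists2 j, j < 3 ^ n & k = (2 * j).+2) \/
               (exists2 j, j < 3 ^ n & k = (2 * j).+1).
  have := odd_double_half k.-1; case: (odd _) => /= eq_k; [left|right];
    exists (k.-1)./2; lia.
split=> [n_gt1|n_eq1].
  have v1 := @logn3_stirling1_odd n 0 _ n_gt0.
  rewrite muln0 add0n logn1 addn0 expn_gt0 in v1.
  have {v1} v1 := v1 isT; have c1 := cval1 n.
  rewrite v1; split; last lia.
  case: cases_k => -[j lt_j ->].
    rewrite logn3_stirling1_even //.
    by have := @cval_le n j.+1 n_gt0 isT; lia.
  by rewrite logn3_stirling1_odd //; have := cval_odd_le n_gt1 lt_j; lia.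
move: k_le cases_k; rewrite {}n_eq1 => k_le cases_k.
(* Here [cval 1 2] is 0 and v3(3) = 1, so the value is 0 + 1 + 1. *)
have v3 := @logn3_stirling1_odd 1 1 isT isT.
rewrite v3; split=> //.
case: cases_k => -[j lt_j ->].
  rewrite (@logn3_stirling1_even 1) //.
  by have := @cval_le 1 j.+1 isT isT; lia.
rewrite (@logn3_stirling1_odd 1) //.
by case: j lt_j => [|[|[|]]].
Qed.
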